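(* Let $d>0$ and let $a,b\ge 0$ be real numbers with $a+b>0$ and $a+b\le d$. Let $\mathcal{R}_d$ be the lattice of parallel lines at distance $d$ apart in the plane, and let $\mathcal{N}_{a,b}$ be the pivot needle consisting of two line segments $C'A'$ and $C'B'$ of lengths $a=|C'A'|$ and $b=|C'B'|$ connected in the pivot point $C'$, thrown at random onto $\mathcal{R}_d$. For $i\in\{0,1,2\}$ let $p(i)$ be the probability that $\mathcal{N}_{a,b}$ hits $\mathcal{R}_d$ in exactly $i$ points. Then $$p(0)=1-\frac{(a+b)(\pi+2E(k))}{\pi^2 d},\qquad p(1)=\frac{4(a+b)E(k)}{\pi^2 d},\qquad p(2)=\frac{(a+b)(\pi-2E(k))}{\pi^2 d},$$ where $$E(k)=\int_0^{\pi/2}\sqrt{1-k^2\sin^2\theta}\;\mathrm{d}\theta$$ is the complete elliptic integral of the second kind with $k^2=\dfrac{4ab}{(a+b)^2}$, $k\ge 0$.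
   Context: The lattice $\mathcal{R}_d$ is the union of the horizontal lines $\{(x,y)\in\mathbb{R}^2 : y=jd\}$, $j\in\mathbb{Z}$. The random throw of $\mathcal{N}_{a,b}$ onto $\mathcal{R}_d$ is defined as follows. The $y$-coordinate of the point $C'$ is a random variable uniformly distributed in $[0,d]$ (the $x$-coordinate of $C'$ is irrelevant and may be fixed arbitrarily). The angles $\alpha$ and $\beta$ between the (direction of the) lines of $\mathcal{R}_d$ and the segments $C'A'$ and $C'B'$, respectively, are random variables uniformly distributed in $[0,2\pi]$, so that $A'=C'+a(\cos\alpha,\sin\alpha)$ and $B'=C'+b(\cos\beta,\sin\beta)$. All three random variables ($y$-coordinate of $C'$, $\alpha$, $\beta$) are stochastically independent. In particular the angle at the pivot is not fixed. The needle $\mathcal{N}_{a,b}$ is the union of the two closed segments $C'A'$ and $C'B'$, and ''$\mathcal{N}_{a,b}$ hits $\mathcal{R}_d$ in exactly $i$ points'' means that the set $\mathcal{N}_{a,b}\cap\mathcal{R}_d$ has exactly $i$ elements. *)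

(* Defs.v *)
From HB Require Import structures.
From mathcomp Require Import all_boot all_order all_algebra.
From mathcomp Require Import all_classical all_reals all_analysis.

Set Implicit Arguments.
Unset Strict Implicit.
Unset Printing Implicit Defensive.

Import Order.TTheory GRing.Theory Num.Theory.
Import numFieldNormedType.Exports.

Local Open Scope classical_set_scope.
Local Open Scope card_scope.
Local Open Scope ring_scope.

Definition line_lattice (R : realType) (d : R) : set (R * R) :=
  [set z | exists j : int, z.2 = j%:~R * d].

Definition segment (R : realType) (p q : R * R) : set (R * R) :=
  [set z | exists t : R, 0 <= t <= 1 /\
    z = (p.1 + t * (q.1 - p.1), p.2 + t * (q.2 - p.2))].

Definition polar_shift (R : realType) (c : R * R) (r phi : R) : R * R :=
  (c.1 + r * cos phi, c.2 + r * sin phi).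

Definition pivot_needle (R : realType) (a b : R) (c : R * R) (alpha beta : R)
    : set (R * R) :=
  segment c (polar_shift c a alpha) `|` segment c (polar_shift c b beta).

(* Only measurable sets are compared: the two set functions may differ on
   other sets. *)
Definition uniformly_distributed (d : measure_display) (T : measurableType d)
    (R : realType) (P : probability T R) (X : {RV P >-> R}) (u v : R) : Prop :=
  exists uv : u < v, forall A : set R, measurable A ->
    distribution P X A = uniform_prob uv A.

(* Mutual independence of the three variables; the product rule for pairs is
   the case where one of the sets is setT. *)
Definition independent3 (d : measure_display) (T : measurableType d)
    (R : realType) (P : probability T R) (X Y Z : {RV P >-> R}) : Prop :=
  forall A B C : set R, measurable A -> measurable B -> measurable C ->
    P (X @^-1` A `&` Y @^-1` B `&` Z @^-1` C) =
    (P (X @^-1` A) * P (Y @^-1` B) * P (Z @^-1` C))%E.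

(* The event that the needle with random pivot ordinate Y, fixed pivot abscissa
   x0 and random angles alpha, beta meets the lattice in exactly i points. *)
Definition hits_exactly (R : realType) (T : Type) (d a b x0 : R)
    (Y alpha beta : T -> R) (i : nat) : set T :=
  [set w | pivot_needle a b (x0, Y w) (alpha w) (beta w) `&` line_lattice d
           #= `I_i].

Definition ellipticE (R : realType) (k : R) : R :=
  \int[@lebesgue_measure R]_(t in `[0, pi / 2])
    Num.sqrt (1 - k ^+ 2 * sin t ^+ 2).

(* Main.v *)
Require Import Defs.
From HB Require Import structures.
From mathcomp Require Import all_boot all_order all_algebra.
From mathcomp Require Import all_classical all_reals all_analysis.
From mathcomp Require Import measurable_realfun ring lra.

Set Implicit Arguments.
Unset Strict Implicit.
Unset Printing Implicit Defensive.

Import Order.TTheory GRing.Theory Num.Theory.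
Import numFieldNormedType.Exports.

Local Open Scope classical_set_scope.
Local Open Scope ring_scope.

(** Put s = a sin(alpha) and t = b sin(beta). Up to null events the needle misses
    the lattice iff 0, s and t, shifted by the ordinate y of the pivot, all lie in
    ]0, d[; since a + b <= d, the complementary event has conditional probability
    (max(0,s,t) - min(0,s,t)) / d = (|s| + |t| + |s - t|) / (2d). The mean of |s| is
    2a/pi. For |s - t|, put beta = alpha + theta: for fixed theta it is the absolute
    projection of a rotating vector of length sqrt(a^2 + b^2 - 2ab cos(theta)),
    whose mean over theta is an elliptic integral (half-angle substitution). The
    same computation with b = 0 or a = 0 gives the probability that one given arm
    hits, and inclusion-exclusion the probability p(2) that both arms hit; they
    then hit at distinct points unless alpha = beta. Finally
    p(1) = 1 - p(0) - p(2). *)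

(** * Integrals of continuous and periodic functions *)

Section affine.
Context {R : realType}.
Implicit Types f : R -> R.
Local Notation mu := (@lebesgue_measure R).

Lemma integral_affine_substitution f (c e x y : R) : 0 < c -> x <= y -> continuous f ->
  (\int[mu]_(t in `[(c * x + e)%R, (c * y + e)%R]) (f t)%:E =
   \int[mu]_(t in `[x, y]) (f (c * t + e)%R * c)%:E)%E.
Proof.
move=> c0 xy cf.
have dF t : is_derive t (1:R) (fun t : R => c * t + e) c.
  by apply: is_derive_eq; rewrite addr0 -[RHS]mulr1.
have F' : derive1 (fun t : R => c * t + e) = cst c.
  by apply/funext => t; rewrite derive1E derive_val.
have cF : continuous (fun t : R => c * t + e).
  by move=> t; apply: differentiable_continuous; apply/derivable1_diffP; case: (dF t).
rewrite (@integration_by_substitution_increasing _ (fun t : R => c * t + e) f x y) //.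
- by apply: eq_integral => t _; rewrite F'.
- by move=> u v _ _ uv; rewrite ltrD2r ltr_pM2l.
- by rewrite F' => ? _; exact: cvg_cst.
- by rewrite F'; exact: is_cvg_cst.
- by rewrite F'; exact: is_cvg_cst.
- split => //.
  + by apply: cvg_at_right_filter; exact: cF.
  + by apply: cvg_at_left_filter; exact: cF.
- exact: continuous_subspaceT.
Qed.

Lemma integral_itv_cat f (x y z : R) : x <= y -> y <= z -> continuous f ->
  (forall t, 0 <= f t) ->
  (\int[mu]_(t in `[x, z]) (f t)%:E =
   \int[mu]_(t in `[x, y]) (f t)%:E + \int[mu]_(t in `[y, z]) (f t)%:E)%E.
Proof.
move=> xy yz cf f0.
have mf (D : set R) : measurable_fun D (EFin \o f).
  by apply/measurable_EFinP/measurable_funTS; exact: continuous_measurable_fun.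
rewrite -(@integral_itv_obnd_cbnd _ y (BRight z) (fun t => (f t)%:E))//.
rewrite -(@ge0_integral_setU _ _ _ mu `[x, y]%classic `]y, z]%classic)//.
- by rewrite -itv_bndbnd_setU// bnd_simp.
- exact: mf.
- by move=> t _; rewrite lee_fin.
- apply/disj_setPS => t /=; rewrite !in_itv/= => -[/andP[_ ty] /andP[yt _]].
  by move: (lt_le_trans yt ty); rewrite ltxx.
Qed.

Lemma periodic_addz f (T : R) (m : int) (x : R) : (forall t, f (t + T) = f t) ->
  f (x + m%:~R * T) = f x.
Proof.
move=> fT; have fTn n y : f (y + n%:R * T) = f y.
  elim: n => [|n IH]; first by rewrite mul0r addr0.
  by rewrite -natr1 mulrDl mul1r addrA fT.
case: m => n; first exact: fTn.
by rewrite NegzE mulrNz -pmulrn -(fTn n.+1) mulNr subrK.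
Qed.

(** After reducing [c] modulo [T], the window from [c] to [T + c] is cut at [T], and the piece
    beyond [T] is moved back by one period onto the interval from 0 to [c]. *)
Lemma integral_periodic_shift f (T c : R) : 0 < T -> continuous f ->
  (forall t, 0 <= f t) -> (forall t, f (t + T) = f t) ->
  (\int[mu]_(t in `[0%R, T]) (f (t + c)%R)%:E = \int[mu]_(t in `[0%R, T]) (f t)%:E)%E.
Proof.
move=> T0 cf f0 fT.
wlog [c0 cT] : c / 0 <= c /\ c <= T.
  move=> wl; pose m := Num.floor (c / T); pose c' := c - m%:~R * T.
  rewrite -(wl c').
    by apply: eq_integral => t _; rewrite -(periodic_addz m (t + c') fT) -addrA subrK.
  have /andP[m1 m2] := floor_itv (c / T).
  move: m1 m2; rewrite ler_pdivlMr// ltr_pdivrMr// -/m intrD mulrDl mul1r /c' => m1 m2.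
  by split; lra.
have tr x y e : x <= y ->
    (\int[mu]_(t in `[(x + e)%R, (y + e)%R]) (f t)%:E =
     \int[mu]_(t in `[x, y]) (f (t + e)%R)%:E)%E.
  move=> xy; have := @integral_affine_substitution f 1 e x y ltr01 xy cf.
  rewrite !mul1r => ->.
  by apply: eq_integral => t _; rewrite mul1r mulr1.
rewrite -tr ?ltW// add0r (@integral_itv_cat _ c T)//; last by rewrite lerDl.
rewrite addeC
  [RHS](@integral_itv_cat _ 0 c)//; congr (_ + _)%E.
rewrite [(T + c)%R]addrC -[X in `[X, _]]add0r tr//.
by apply: eq_integral => t _; rewrite fT.
Qed.
End affine.

(** * Integrals of sinusoids over a full period *)

Section circle_integrals.
Context {R : realType}.
Local Notation mu := (@lebesgue_measure R).

Lemma sin_periodic (x : R) : sin (x + 2 * pi) = sin x.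
Proof. by rewrite mulr_natl sinD2pi. Qed.

Lemma cos_periodic (x : R) : cos (x + 2 * pi) = cos x.
Proof. by rewrite mulr_natl cosD2pi. Qed.

Lemma integral_sin_0pi : (\int[mu]_(t in `[0%R, pi]) (sin t)%:E = 2%:E)%E.
Proof.
have dF t : is_derive t (1:R) (fun t : R => - cos t) (sin t).
  by apply: is_derive_eq; rewrite opprK.
have cF : continuous (fun t : R => - cos t).
  by move=> t; apply: continuousN; exact: continuous_cos.
rewrite (@continuous_FTC2 _ (@sin R) (fun t => - cos t)) ?pi_gt0//.
- by rewrite cospi cos0 opprK -EFinN -EFinD opprK.
- by apply: continuous_subspaceT; exact: continuous_sin.
- split => //.
  + by apply: cvg_at_right_filter; exact: cF.
  + by apply: cvg_at_left_filter; exact: cF.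
- by move=> t _; rewrite derive1E derive_val.
Qed.

Lemma integral_abs_sin : (\int[mu]_(t in `[0%R, (2 * pi)%R]) `|sin t|%:E = 4%:E)%E.
Proof.
have p0 := pi_gt0 R.
have c : continuous (fun t : R => `|sin t|).
  by move=> t; apply: continuous_comp; [exact: continuous_sin|exact: norm_continuous].
have -> : (4 : R) = 2 + 2 by ring.
have e1 : (\int[mu]_(t in `[0%R, pi]) `|sin t|%:E = 2%:E)%E.
  rewrite -integral_sin_0pi; apply: eq_integral => t; rewrite inE/= in_itv/= => tp.
  by rewrite ger0_norm// sin_ge0_pi.
rewrite (@integral_itv_cat _ _ 0 pi)//; [|lra|lra].
rewrite EFinD e1; congr (_ + _)%E; rewrite -e1.
have := @integral_affine_substitution _ (fun t => `|sin t|) 1 pi 0 pi ltr01 (ltW p0) c.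
rewrite mulr0 add0r mul1r (_ : pi + pi = 2 * pi :> R); last by ring.
by move=> ->; apply: eq_integral => t _; rewrite mul1r mulr1 sinDpi normrN.
Qed.

(** The angle is the arc cosine of [A / r], negated when [B] is negative, since the sine of an arc
    cosine is never negative. For [r = 0] any angle works. *)
Lemma polar_coordinates (A B : R) : exists phi : R,
  A = Num.sqrt (A ^+ 2 + B ^+ 2) * cos phi /\ B = Num.sqrt (A ^+ 2 + B ^+ 2) * sin phi.
Proof.
set r := Num.sqrt _.
have s0 : 0 <= A ^+ 2 + B ^+ 2 by rewrite addr_ge0 ?sqr_ge0.
have r2 : r ^+ 2 = A ^+ 2 + B ^+ 2 by rewrite sqr_sqrtr.
have [r0|] := eqVneq r 0.
  move/eqP: r2; rewrite r0 expr0n/= eq_sym paddr_eq0 ?sqr_ge0// !sqrf_eq0.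
  move=> /andP[/eqP -> /eqP ->]; by exists 0; rewrite !mul0r.
move=> rn0; have rp : 0 < r by rewrite lt_neqAle eq_sym rn0 sqrtr_ge0.
have Ar : -1 <= A / r <= 1.
  rewrite -ler_norml normrM normfV (gtr0_norm rp) ler_pdivrMr// mul1r.
  by rewrite -(gtr0_norm rp) -ler_sqr ?nnegrE// !real_normK ?num_real// r2 lerDl sqr_ge0.
have sa : sin (acos (A / r)) = `|B| / r.
  rewrite sin_acos//.
  have -> : 1 - (A / r) ^+ 2 = (`|B| / r) ^+ 2.
    by rewrite !expr_div_n real_normK ?num_real//
      (_ : B ^+ 2 = r ^+ 2 - A ^+ 2); [field|rewrite r2; ring].
  by rewrite sqrtr_sqr ger0_norm// divr_ge0// ltW.
have [B0|B0] := leP 0 B.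
- exists (acos (A / r)); split.
  + by rewrite acosK// mulrCA divff// mulr1.
  + by rewrite sa ger0_norm// mulrCA divff// mulr1.
- exists (- acos (A / r)); split.
  + by rewrite cosN acosK// mulrCA divff// mulr1.
  + by rewrite sinN sa ltr0_norm// mulNr opprK mulrCA divff// mulr1.
Qed.

(** The integrand is a translate of |sin| scaled by the amplitude, and a translation does not change
    the integral over a period. *)
Lemma integral_abs_sin_cos (A B : R) :
  (\int[mu]_(t in `[0%R, (2 * pi)%R]) `|A * sin t + B * cos t|%:E =
   (4 * Num.sqrt (A ^+ 2 + B ^+ 2))%:E)%E.
Proof.
have [phi [eA eB]] := polar_coordinates A B.
set r := Num.sqrt _ in eA eB *.
have c : continuous (fun t : R => `|sin t|).
  by move=> t; apply: continuous_comp; [exact: continuous_sin|exact: norm_continuous].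
have p2 : 0 < 2 * pi :> R by rewrite mulr_gt0 ?pi_gt0.
rewrite EFinM muleC -integral_abs_sin.
rewrite -(@integral_periodic_shift _ (fun t => `|sin t|) (2 * pi) phi)//; last first.
  by move=> t; rewrite sin_periodic.
rewrite -ge0_integralZl_EFin//.
- apply: eq_integral => t _.
  rewrite -EFinM -{1}(ger0_norm (sqrtr_ge0 _ : 0 <= r)) -normrM sinD.
  by congr (`| _ |%:E); rewrite {1}eA {1}eB; ring.
- apply/measurable_EFinP/measurable_funTS; apply: continuous_measurable_fun => t.
  apply: (@continuous_comp _ _ _ (fun t => t + phi) (fun t : R => `|sin t|)); last exact: c.
  by apply: continuousD; [exact: cvg_id|exact: cvg_cst].
- exact: sqrtr_ge0.
Qed.
End circle_integrals.

(** * The complete elliptic integral *)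

Section elliptic.
Context {R : realType}.
Local Notation mu := (@lebesgue_measure R).

Lemma continuous_ellipticE_integrand (k : R) :
  continuous (fun t : R => Num.sqrt (1 - k ^+ 2 * sin t ^+ 2)).
Proof.
move=> t; apply: (@continuous_comp _ _ _ (fun t : R => 1 - k ^+ 2 * sin t ^+ 2)).
  apply: continuousB; first exact: cvg_cst.
  apply: continuousM; first exact: cvg_cst.
  by apply: continuousM; exact: continuous_sin.
exact: sqrt_continuous.
Qed.

(** The real integral is the [fine] part of the extended one, which is finite because the integrand
    is continuous on a compact interval. *)
Lemma EFin_ellipticE (k : R) : ((ellipticE k)%:E =
  \int[mu]_(t in `[0%R, (pi / 2)%R]) (Num.sqrt (1 - k ^+ 2 * sin t ^+ 2))%:E)%E.
Proof.
rewrite /ellipticE /Rintegral fineK//; apply: integrable_fin_num => //.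
apply: continuous_compact_integrable; first exact: segment_compact.
by apply: continuous_subspaceT; exact: continuous_ellipticE_integrand.
Qed.

(** The integrand is symmetric about pi / 2. The reflection is made in two moves: t becomes -t, then
    a translation by pi follows. *)
Lemma integral_ellipticE_integrand (k : R) :
  (\int[mu]_(t in `[0%R, pi]) (Num.sqrt (1 - k ^+ 2 * sin t ^+ 2))%:E =
   (2 * ellipticE k)%:E)%E.
Proof.
have p0 := pi_gt0 R.
have cq := @continuous_ellipticE_integrand k.
set q := (fun t : R => Num.sqrt (1 - k ^+ 2 * sin t ^+ 2)) in cq *.
have q0 t : 0 <= q t by exact: sqrtr_ge0.
have qpi t : q (t - pi) = q t.
  by rewrite /q -[in RHS](subrK pi t) sinDpi sqrrN.
have qN t : q (- t) = q t by rewrite /q sinN sqrrN.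
rewrite -/(q _) (@integral_itv_cat _ q 0 (pi / 2))//; [|lra|lra].
have -> : (\int[mu]_(t in `[(pi / 2)%R, pi]) (q t)%:E =
    \int[mu]_(t in `[0%R, (pi / 2)%R]) (q t)%:E)%E.
  transitivity (\int[mu]_(t in `[(pi / 2)%R, pi]) ((q \o -%R) t)%:E)%E.
    by apply: eq_integral => t _; rewrite /= qN.
  rewrite -integration_by_substitution_oppr; [|lra|exact: continuous_subspaceT].
  have := @integral_affine_substitution _ q 1 (- pi) 0 (pi / 2) ltr01.
  rewrite mulr0 add0r mul1r (_ : pi / 2 - pi = - (pi / 2)); last by field.
  move=> ->//; last by lra.
  by apply: eq_integral => t _; rewrite mul1r mulr1 qpi.
by rewrite -EFin_ellipticE -EFinD; congr EFin; ring.
Qed.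

(** The integrand is the third side of a triangle with sides [a], [b] enclosing the angle t.
    Replacing t by t + pi turns its square into a^2 + b^2 + 2ab cos t = (a + b)^2 (1 - k^2
    sin^2(t/2)), and t/2 runs from 0 to pi. *)
Lemma integral_chord_length (a b k : R) : 0 < a + b ->
  k ^+ 2 = 4 * a * b / (a + b) ^+ 2 ->
  (\int[mu]_(t in `[0%R, (2 * pi)%R])
     (Num.sqrt ((a - b * cos t) ^+ 2 + (b * sin t) ^+ 2))%:E =
   (4 * (a + b) * ellipticE k)%:E)%E.
Proof.
move=> ab hk; have p0 := pi_gt0 R.
have cq := @continuous_ellipticE_integrand k.
set q := (fun t : R => Num.sqrt (1 - k ^+ 2 * sin t ^+ 2)) in cq *.
have cf : continuous (fun t : R => Num.sqrt ((a - b * cos t) ^+ 2 + (b * sin t) ^+ 2)).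
  move=> t; apply: (@continuous_comp _ _ _
    (fun t : R => (a - b * cos t) ^+ 2 + (b * sin t) ^+ 2)); last exact: sqrt_continuous.
  have c1 : {for t, continuous (fun t : R => a - b * cos t)}.
    apply: continuousB; first exact: cvg_cst.
    by apply: continuousM; [exact: cvg_cst|exact: continuous_cos].
  have c2 : {for t, continuous (fun t : R => b * sin t)}.
    by apply: continuousM; [exact: cvg_cst|exact: continuous_sin].
  by apply: continuousD; apply: continuousM.
have p2 : 0 < 2 * pi :> R by rewrite mulr_gt0.
rewrite -(integral_periodic_shift pi p2 cf); last 2 first.
- by move=> t; exact: sqrtr_ge0.
- by move=> t; rewrite sin_periodic cos_periodic.
have -> : 4 * (a + b) * ellipticE k = (2 * (a + b)) * (2 * ellipticE k) by ring.
rewrite EFinM -integral_ellipticE_integrand -ge0_integralZl_EFin//; last 2 first.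
- by apply/measurable_EFinP/measurable_funTS; exact: continuous_measurable_fun.
- by rewrite mulr_ge0// ltW.
have := @integral_affine_substitution _ (fun t => 2 * (a + b) * q t) (2^-1) 0 0 (2 * pi).
rewrite mulr0 !addr0 mulKf// => ->; last 3 first.
- by rewrite invr_gt0.
- by rewrite mulr_ge0// ltW.
- move=> t; apply: (@continuousM _ _ (fun=> 2 * (a + b)) q); [exact: cvg_cst|exact: cq].
apply: eq_integral => t _; congr EFin.
rewrite cosDpi sinDpi addr0 /q.
have ct : cos t = 1 - 2 * sin (2^-1 * t) ^+ 2.
  rewrite [in LHS](_ : t = (2^-1 * t) *+ 2); last by rewrite -mulr_natl; field.
  by rewrite cos_mulr2n cos2sin2; ring.
set s := sin (2^-1 * t) in ct *.
rewrite (_ : _ + _ = (a + b) ^+ 2 * (1 - k ^+ 2 * s ^+ 2)).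
  by rewrite sqrtrM ?sqr_ge0// sqrtr_sqr gtr0_norm//; field.
transitivity (a ^+ 2 + b ^+ 2 + 2 * a * b * cos t).
  by rewrite [X in _ + X]exprMn sqrrN sin2cos2; ring.
by rewrite hk ct; field; rewrite gt_eqF.
Qed.

End elliptic.

(** * Mean values over uniform angles *)

Section circle_means.
Context {R : realType}.
Local Notation mu := (@lebesgue_measure R).
Variable h : (0 : R) < 2 * pi.
Local Notation U := (uniform_prob h).

Lemma measurable_sinT d (T : measurableType d) (f : T -> R) :
  measurable_fun setT f -> measurable_fun setT (fun x => sin (f x)).
Proof.
move=> mf; apply: measurableT_comp mf.
exact: (continuous_measurable_fun (@continuous_sin R)).
Qed.

Lemma measurable_cosT d (T : measurableType d) (f : T -> R) :
  measurable_fun setT f -> measurable_fun setT (fun x => cos (f x)).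
Proof.
move=> mf; apply: measurableT_comp mf.
exact: (continuous_measurable_fun (@continuous_cos R)).
Qed.

Lemma measurable_normT d (T : measurableType d) (f : T -> R) :
  measurable_fun setT f -> measurable_fun setT (fun x => `|f x|).
Proof. by move=> mf; exact: (measurableT_comp (@normr_measurable R setT) mf). Qed.

Lemma mean_circle (f : R -> R) : measurable_fun setT f -> (forall x, 0 <= f x) ->
  (\int[U]_x (f x)%:E =
   ((2 * pi)^-1)%:E * \int[mu]_(x in `[0%R, (2 * pi)%R]) (f x)%:E)%E.
Proof.
by move=> mf f0; rewrite integral_uniform ?subr0//; exact/measurable_EFinP.
Qed.

Lemma mean_abs_sin_cos (A B : R) :
  (\int[U]_x `|A * sin x + B * cos x|%:E =
   (2 / pi * Num.sqrt (A ^+ 2 + B ^+ 2))%:E)%E.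
Proof.
rewrite mean_circle//.
  rewrite integral_abs_sin_cos -EFinM; congr EFin.
  by move: (@pi R) (pi_gt0 R) => p p0; field; rewrite gt_eqF.
apply: measurable_normT; apply: measurable_funD; apply: measurable_funM => //.
  exact: measurable_sinT.
exact: measurable_cosT.
Qed.

Lemma mean_abs_sin (a : R) : 0 <= a ->
  (\int[U]_x `|a * sin x|%:E = (2 * a / pi)%:E)%E.
Proof.
move=> a0; have := mean_abs_sin_cos a 0.
rewrite expr0n/= addr0 sqrtr_sqr ger0_norm// => H.
transitivity (2 / pi * a)%:E; last by rewrite mulrAC.
by rewrite -H; apply: eq_integral => x _; rewrite mul0r addr0.
Qed.

(* Substituting beta = alpha + theta turns the average over alpha into that of a
   projection of a vector whose length is the distance of the two endpoints. *)
Lemma mean_abs_sin_sub (a b k : R) : 0 < a + b ->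
  k ^+ 2 = 4 * a * b / (a + b) ^+ 2 ->
  (\int[U]_x \int[U]_y `|a * sin x - b * sin y|%:E =
   (4 * (a + b) * ellipticE k / pi ^+ 2)%:E)%E.
Proof.
move=> ab hk; have p0 := pi_gt0 R.
have cs x : continuous (fun y : R => `|a * sin x - b * sin y|).
  move=> y; apply: (@continuous_comp _ _ _ (fun y : R => a * sin x - b * sin y)).
    apply: continuousB; first exact: cvg_cst.
    by apply: continuousM; [exact: cvg_cst|exact: continuous_sin].
  exact: norm_continuous.
transitivity (\int[U]_x \int[U]_y `|a * sin x - b * sin (y + x)|%:E)%E.
  apply: eq_integral => x _; rewrite !mean_circle//; last 2 first.
  - apply: measurable_normT; apply: measurable_funB => //.
    by apply: measurable_funM => //; apply: measurable_sinT; exact: measurable_funD.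
  - exact: continuous_measurable_fun.
  congr (_ * _)%E.
  rewrite -(integral_periodic_shift x h (cs x))//.
  by move=> t; rewrite sin_periodic.
(* Tonelli: the angle y between the arms is now held fixed, and the inner mean is over the common
   rotation x. *)
rewrite (@fubini_tonelli _ _ _ _ R U U
  (fun z : R * R => `|a * sin z.1 - b * sin (z.2 + z.1)|%:E))//; last first.
- apply/measurable_EFinP; apply: measurable_normT; apply: measurable_funB => //.
  + by apply: measurable_funM => //; exact: measurable_sinT.
  + by apply: measurable_funM => //; apply: measurable_sinT; exact: measurable_funD.
transitivity (\int[U]_y (2 / pi * Num.sqrt ((a - b * cos y) ^+ 2 + (b * sin y) ^+ 2))%:E)%E.
  (* For fixed y the projection is (a - b cos y) sin x - (b sin y) cos x; the minus sign disappears
     in the squared amplitude. *)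
  apply: eq_integral => y _; rewrite -(sqrrN (b * sin y)) -mean_abs_sin_cos.
  by apply: eq_integral => x _; rewrite sinD; congr (`| _ |%:E); ring.
have msq : measurable_fun setT (fun y : R => Num.sqrt ((a - b * cos y) ^+ 2 + (b * sin y) ^+ 2)).
  apply: (measurableT_comp (continuous_measurable_fun (@sqrt_continuous R))).
  apply: measurable_funD; apply: measurable_funX.
    by apply: measurable_funB => //; apply: measurable_funM => //; exact: measurable_cosT.
  by apply: measurable_funM => //; exact: measurable_sinT.
rewrite mean_circle; last 2 first.
- exact: measurable_funM.
- by move=> y; rewrite mulr_ge0 ?sqrtr_ge0// divr_ge0// ltW.
under eq_integral do rewrite EFinM.
rewrite ge0_integralZl_EFin//; last 2 first.
- exact/measurable_EFinP/measurable_funTS.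
- by rewrite divr_ge0// ltW.
rewrite (integral_chord_length ab hk) -!EFinM; congr EFin.
by clear -p0; move: (@pi R) p0 => p p0; field; rewrite gt_eqF.
Qed.
End circle_means.

(** * Joint laws of independent variables *)

Section joint_law.
Context d (T : measurableType d) d1 (T1 : measurableType d1) d2 (T2 : measurableType d2).
Context {R : realType}.

(** A measure that agrees with a sigma-finite product on rectangles is that product. [m] is any
    measure, so that the restriction of a probability to an event is covered too. *)
Lemma joint_law_product (m : {measure set T -> \bar R})
    (m1 : {sigma_finite_measure set T1 -> \bar R})
    (m2 : {sigma_finite_measure set T2 -> \bar R}) (X : T -> T1) (Y : T -> T2) :
  measurable_fun setT X -> measurable_fun setT Y ->
  (forall A B, measurable A -> measurable B ->
    m (X @^-1` A `&` Y @^-1` B) = (m1 A * m2 B)%E) ->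
  forall C, measurable C -> m ((fun w => (X w, Y w)) @^-1` C) = (m1 \x m2)%E C.
Proof.
move=> mX mY mXY C mC; have mZ := measurable_fun_pair mX mY.
pose Zmix := isMeasurableFun.Build _ _ _ _ _ mZ.
pose Z : {mfun T >-> (T1 * T2)%type} := HB.pack (fun w => (X w, Y w)) Zmix.
rewrite (@product_measure_unique _ _ _ _ _ m1 m2 (pushforward m Z))//.
Qed.

End joint_law.

Section triple_law.
Context d (T : measurableType d) {R : realType} (P : probability T R).
Context d1 (T1 : measurableType d1) d2 (T2 : measurableType d2) d3 (T3 : measurableType d3).
Variables (m1 : probability T1 R) (m2 : probability T2 R) (m3 : probability T3 R).
Variables (X : T -> T1) (Y : T -> T2) (Z : T -> T3).
Hypotheses (mX : measurable_fun setT X) (mY : measurable_fun setT Y)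
  (mZ : measurable_fun setT Z).
Hypothesis XYZ : forall A B C, measurable A -> measurable B -> measurable C ->
  P (X @^-1` A `&` Y @^-1` B `&` Z @^-1` C) = (m1 A * m2 B * m3 C)%E.

Lemma joint_law_product2 C : measurable C ->
  P ((fun w => (X w, Y w)) @^-1` C) = (m1 \x m2)%E C.
Proof.
apply: joint_law_product => // A B mA mB.
by have := XYZ mA mB measurableT; rewrite preimage_setT setIT probability_setT mule1.
Qed.

(** The pair and [Z] must be compared on sets A x B where A is any measurable set of pairs, whereas
    the hypothesis only speaks of rectangles A. For fixed B, the two-variable result is therefore
    applied to [P] restricted to the event that [Z] lies in B. *)
Lemma joint_law_product3 C : measurable C ->
  P ((fun w => ((X w, Y w), Z w)) @^-1` C) = ((m1 \x m2) \x m3)%E C.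
Proof.
move=> mC; have mXY := measurable_fun_pair mX mY.
pose m12 : probability (T1 * T2)%type R := (m1 \x m2)%E.
apply: (@joint_law_product _ T _ (T1 * T2)%type _ T3 R P m12 m3 _ Z mXY mZ _ _ mC).
move=> A B mA mB.
have mZB : measurable (Z @^-1` B) by rewrite -[X in measurable X]setTI; exact: mZ.
have r0 : 0 <= fine (m3 B) by rewrite fine_ge0.
pose r := NngNum r0.
(* The constant [m3 B] is absorbed into the second factor, which makes the right-hand side a product
   measure again. *)
have -> : ((m1 \x m2) A * m3 B = (m1 \x mscale r m2) A)%E.
  rewrite muleC -[m3 B]fineK ?fin_num_measure//.
  rewrite /product_measure1 -ge0_integralZl_EFin//.
  exact: measurable_fun_xsection.
rewrite -(@joint_law_product _ _ _ _ _ _ _ (mrestr P mZB) m1 (mscale r m2) X Y)//.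
move=> A' B' mA' mB'; transitivity (P (X @^-1` A' `&` Y @^-1` B' `&` Z @^-1` B)) => //.
rewrite XYZ// -muleA [(m2 B' * _)%E]muleC; congr (_ * _)%E.
by rewrite /mscale; congr (_ * _)%E; rewrite /= fineK// fin_num_measure.
Qed.
End triple_law.

(** * Uniform law and avoidance of the lines *)

Section uniform_sets.
Context {R : realType}.

Lemma uniform_prob_oo (x y u v : R) (xy : x < y) : x <= u -> u <= v -> v <= y ->
  uniform_prob xy `]u, v[ = ((v - u) / (y - x))%:E.
Proof.
move=> xu uv vy; rewrite /uniform_prob integral_uniform_pdf setIidl; last first.
  move=> t /=; rewrite !in_itv/= => /andP[ut tv].
  by rewrite (le_trans xu (ltW ut)) (le_trans (ltW tv) vy).
rewrite (eq_integral (fun=> (y - x)^-1%:E)); last first.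
  move=> t; rewrite inE/= in_itv/= /uniform_pdf => /andP[ut tv].
  by rewrite (le_trans xu (ltW ut)) (le_trans (ltW tv) vy).
rewrite integral_cst//= lebesgue_measure_itv/= lte_fin.
move: uv; rewrite le_eqVlt => /predU1P[->|uv]; first by rewrite ltxx mule0 subrr mul0r.
by rewrite uv -EFinD -EFinM mulrC.
Qed.

Lemma uniform_prob_countable (x y : R) (xy : x < y) (A : set R) : measurable A ->
  countable (A `&` `[x, y]) -> uniform_prob xy A = 0%E.
Proof.
move=> mA cA; rewrite /uniform_prob integral_uniform_pdf null_set_integral//.
- exact: measurableI.
- by apply/measurable_EFinP/measurable_funTS; exact: measurable_uniform_pdf.
- exact: countable_lebesgue_measure0.
Qed.

Variable h : (0 : R) < 2 * pi.
Local Notation U := (uniform_prob h).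

Lemma measurable_same_cos : measurable [set z : R * R | cos z.1 = cos z.2].
Proof.
have -> : [set z : R * R | cos z.1 = cos z.2] =
    setT `&` (fun z => cos z.1 - cos z.2) @^-1` [set 0].
  apply/seteqP; split => z /=; first by move=> ->; rewrite subrr.
  by move=> [_ /eqP]; rewrite subr_eq0 => /eqP.
apply: measurable_funB => //; exact: measurable_cosT.
Qed.

(** In a period an angle is determined by its cosine up to reflection, so each section has at most
    two points in the support of the uniform law. *)
Lemma same_cos_null : (U \x U)%E [set z : R * R | cos z.1 = cos z.2] = 0%E.
Proof.
rewrite /product_measure1 (eq_integral (cst 0%E)); first by rewrite integral0.
move=> x _ /=; apply: uniform_prob_countable.
  by apply: measurable_xsection; exact: measurable_same_cos.
have p0 := pi_gt0 R.
apply: (@sub_countable _ _ _ [set acos (cos x); 2 * pi - acos (cos x)]).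
  apply: subset_card_le => y [/xsectionP/= -> /=]; rewrite in_itv/= => /andP[y0 y2].
  have [yp|yp] := leP y pi.
    by left; rewrite cosK// in_itv/= y0 yp.
  right; rewrite -(cosN y) -(cos_periodic (- y)) cosK; last by rewrite in_itv/=; lra.
  by ring.
exact: finite_set_countable.
Qed.
End uniform_sets.

Section avoidance.
Context {R : realType}.
Implicit Types s t d : R.

(* Half the perimeter of the degenerate triangle with vertices 0, s, t. *)
Lemma range_half_perimeter s t :
  Num.max 0 (Num.max s t) - Num.min 0 (Num.min s t) = (`|s| + `|t| + `|s - t|) / 2.
Proof.
rewrite !maxEle !minEle.
case: (ger0P s) => s0; case: (ger0P t) => t0; case: (ger0P (s - t)) => st;
  case: (leP s t) => st'; case: ifPn; rewrite -?ltNge => M; case: ifPn;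
  rewrite -?ltNge => m; lra.
Qed.

Lemma avoid_itv s t d : [set v | [/\ 0 < v < d, 0 < v + s < d & 0 < v + t < d]] =
  `]- Num.min 0 (Num.min s t), d - Num.max 0 (Num.max s t)[%classic.
Proof.
apply/seteqP; split => v /=; rewrite in_itv/= ltrNl ltrBrDl -ltrBrDr.
  move=> [/andP[? ?] /andP[? ?] /andP[? ?]].
  by rewrite !lt_min !gt_max; apply/andP; split; apply/and3P; split; lra.
rewrite !lt_min !gt_max => /andP[/and3P[? ? ?] /and3P[? ? ?]].
by split; apply/andP; split; lra.
Qed.

(** The avoiding ordinates form an interval of length [d] minus the range of 0, s, t. It lies within
    the strip because 0 is one of the three points, and the hypothesis keeps its endpoints in
    order. *)
Lemma uniform_prob_avoid s t d (d0 : 0 < d) : (`|s| + `|t| + `|s - t|) / 2 <= d ->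
  uniform_prob d0 (~` [set v | [/\ 0 < v < d, 0 < v + s < d & 0 < v + t < d]]) =
  ((`|s| + `|t| + `|s - t|) / (2 * d))%:E.
Proof.
rewrite -range_half_perimeter => wd; rewrite avoid_itv probability_setC//.
have m0 : Num.min 0 (Num.min s t) <= 0 by rewrite ge_min lexx.
have M0 : 0 <= Num.max 0 (Num.max s t) by rewrite le_max lexx.
have := range_half_perimeter s t.
move: (Num.max _ _) (Num.min _ _) wd m0 M0 => M m wd m0 M0 e.
rewrite [X in (1 - X)%E](_ : _ = ((d - M - - m) / (d - 0))%:E); last first.
  by apply: uniform_prob_oo; lra.
rewrite -EFinB; congr EFin; rewrite (_ : `|s| + `|t| + `|s - t| = 2 * (M - m)); last by lra.
by field; rewrite gt_eqF.
Qed.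
End avoidance.

Section avoiding_needles.
Context {R : realType}.
Implicit Types a b d : R.

(* The angles and the pivot ordinate (in this order) for which the pivot and both
   endpoints lie strictly between the lines of ordinates 0 and d. *)
Definition avoiding a b d : set ((R * R) * R) :=
  [set z | [/\ 0 < z.2 < d, 0 < z.2 + a * sin z.1.1 < d &
               0 < z.2 + b * sin z.1.2 < d]].

Lemma measurable_fun_oo disp (T : measurableType disp) (f : T -> R) (u v : R) :
  measurable_fun setT f -> measurable [set x | u < f x < v].
Proof.
move=> mf; have -> : [set x | u < f x < v] = setT `&` f @^-1` `]u, v[.
  by rewrite setTI; apply/seteqP; split => x; rewrite /= in_itv/=.
exact: mf.
Qed.

Lemma measurable_avoiding a b d : measurable (avoiding a b d).
Proof.
have -> : avoiding a b d = [set z | 0 < z.2 < d] `&`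
    [set z | 0 < z.2 + a * sin z.1.1 < d] `&` [set z | 0 < z.2 + b * sin z.1.2 < d].
  by apply/seteqP; split => z /=; [case|case; case].
have m1 : measurable_fun setT (fun z : (R * R) * R => z.1.1).
  exact: measurableT_comp measurable_fst measurable_fst.
have m2 : measurable_fun setT (fun z : (R * R) * R => z.1.2).
  exact: measurableT_comp measurable_snd measurable_fst.
apply: measurableI; first apply: measurableI; apply: measurable_fun_oo => //;
  apply: measurable_funD => //; apply: measurable_funM => //; exact: measurable_sinT.
Qed.

(** An arm of length 0 only repeats the condition on the pivot, so setting a length to 0 isolates
    the other arm. *)
Lemma avoidingE a b d : avoiding a b d = avoiding a 0 d `&` avoiding 0 b d.
Proof.
apply/seteqP; split => z /=; rewrite /avoiding/= !mul0r !addr0.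
  by case.
by case=> -[? ? _] [_ _ ?].
Qed.

Variables (h : (0 : R) < 2 * pi).
Local Notation U := (uniform_prob h).

(** Conditioning on the angles leaves the mean of (|s| + |t| + |s - t|) / (2d). The mean [i2] of the
    last term is a parameter: it is elliptic for the whole needle and elementary when one arm has
    length 0. *)
Lemma product_measure_avoiding a b d (d0 : 0 < d) (i2 : R) :
  0 <= a -> 0 <= b -> a + b <= d ->
  (\int[U]_x \int[U]_y `|a * sin x - b * sin y|%:E = i2%:E)%E ->
  ((U \x U) \x uniform_prob d0)%E (~` avoiding a b d) =
  ((2 * a / pi + 2 * b / pi + i2) / (2 * d))%:E.
Proof.
move=> a0 b0 abd hi2.
have abs1 (c x : R) : 0 <= c -> `|c * sin x| <= c.
  move=> c0; rewrite normrM ger0_norm// ler_piMr// ler_norml.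
  by rewrite sin_geN1 sin_le1.
rewrite {1}/product_measure1.
pose f1 (z : R * R) : R := `|a * sin z.1|.
pose f2 (z : R * R) : R := `|b * sin z.2|.
pose f3 (z : R * R) : R := `|a * sin z.1 - b * sin z.2|.
have ms1 : measurable_fun setT (fun z : R * R => a * sin z.1).
  by apply: measurable_funM => //; exact: measurable_sinT.
have ms2 : measurable_fun setT (fun z : R * R => b * sin z.2).
  by apply: measurable_funM => //; exact: measurable_sinT.
have mf1 : measurable_fun setT (EFin \o f1).
  by apply/measurable_EFinP; exact: measurable_normT.
have mf2 : measurable_fun setT (EFin \o f2).
  by apply/measurable_EFinP; exact: measurable_normT.
have mf3 : measurable_fun setT (EFin \o f3).
  by apply/measurable_EFinP; apply: measurable_normT; exact: measurable_funB.
transitivity (\int[U \x U]_z (((2 * d)^-1)%:E * ((f1 z)%:E + (f2 z)%:E + (f3 z)%:E)))%E.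
  apply: eq_integral => -[x y] _ /=.
  rewrite -!EFinD -EFinM [RHS](_ : _ = ((f1 (x, y) + f2 (x, y) + f3 (x, y)) / (2 * d))%:E);
    last by rewrite mulrC.
  rewrite /f1 /f2 /f3/= -uniform_prob_avoid.
    congr (uniform_prob d0 _); apply/seteqP; split => v.
      by move=> /xsectionP.
    by move=> H; apply/xsectionP.
  (* By the triangle inequality the half perimeter is at most |s| + |t|, hence at most [a + b],
     hence at most [d]. *)
  have := abs1 a x a0; have := abs1 b y b0; have := ler_normB (a * sin x) (b * sin y).
  by lra.
have f10 z : (0 <= (f1 z)%:E)%E by rewrite lee_fin normr_ge0.
have f20 z : (0 <= (f2 z)%:E)%E by rewrite lee_fin normr_ge0.
have f30 z : (0 <= (f3 z)%:E)%E by rewrite lee_fin normr_ge0.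
have i0 : 0 <= (2 * d)^-1 by rewrite invr_ge0 mulr_ge0// ltW.
rewrite ge0_integralZl_EFin//; last 2 first.
- by move=> z _; rewrite !adde_ge0.
- by apply: emeasurable_funD => //; exact: emeasurable_funD.
rewrite ge0_integralD//; last 2 first.
- by move=> z _; rewrite adde_ge0.
- exact: emeasurable_funD.
rewrite ge0_integralD//.
rewrite !fubini_tonelli1//.
rewrite /fubini_F/= hi2.
have -> : (\int[U]_x \int[U]_y (f1 (x, y))%:E = (2 * a / pi)%:E)%E.
  rewrite -(mean_abs_sin h a0); apply: eq_integral => x _.
  rewrite -[LHS]/(\int[U]_y cst `|a * sin x|%:E y)%E.
  by rewrite integral_cst// [X in (_ * X)%E](@probability_setT _ _ _ U) mule1.
have -> : (\int[U]_x \int[U]_y (f2 (x, y))%:E = (2 * b / pi)%:E)%E.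
  rewrite /f2/= (mean_abs_sin h b0).
  rewrite -[LHS]/(\int[U]_x cst (2 * b / pi)%:E x)%E.
  by rewrite integral_cst// [X in (_ * X)%E](@probability_setT _ _ _ U) mule1.
by rewrite -!EFinD -EFinM mulrC.
Qed.
End avoiding_needles.

(** * Lattice points on a needle *)

Section small_cardinals.
Local Open Scope card_scope.
Context {T : Type}.
Implicit Types A : set T.

Lemma card_set2 (p q : T) : p <> q -> [set p; q] #= `I_2.
Proof.
move=> pq; apply/eq_cardSP; exists p; first by left.
have -> : [set p; q] `\ p = [set q]; last exact: card_set1.
apply/seteqP; split => x /=; first by move=> [[->|->]].
by move=> ->; split; [right|exact/nesym].
Qed.

Lemma card_le2_cover A n : (n <= 2)%N -> A #= `I_n ->
  A = set0 \/ exists p q, A `<=` [set p; q].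
Proof.
have c0 B : B #= `I_0 -> B = set0 by rewrite II0 card_eq0 => /eqP.
have c1 B : B #= `I_1 -> exists p, B `<=` [set p].
  move=> /eq_cardSP[p Bp /c0 B0]; exists p => x Bx; apply: contrapT => xp.
  by have : set0 x by rewrite -B0.
case: n => [|[|[|//]]] _.
- by move=> /c0; left.
- by move=> /c1[p Ap]; right; exists p, p => x /Ap; left.
- move=> /eq_cardSP[p _ /c1[q Aq]]; right; exists p, q => x Ax.
  by have [->|xp] := pselect (x = p); [left|right; exact: Aq].
Qed.

(** Pigeonhole. It excludes the counts 0, 1, 2 for an arm contained in a lattice line. *)
Lemma card_ge3 A n (p q r : T) : A p -> A q -> A r -> p <> q -> q <> r -> p <> r ->
  (n <= 2)%N -> ~ (A #= `I_n).
Proof.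
move=> Ap Aq Ar pq qr pr n2 /(card_le2_cover n2)[A0|[u [v Auv]]].
  by rewrite A0 in Ap.
by move: (Auv _ Ap) (Auv _ Aq) (Auv _ Ar) => /= -[|] ep [|] eq [|] er; subst.
Qed.

Lemma card_unique A n m : A #= `I_n -> A #= `I_m -> n = m.
Proof. by move=> An Am; apply/card_eq_II; rewrite -(card_eql An). Qed.
End small_cardinals.

Section geometry.
Context {R : realType}.
Variables (d : R) (d0 : 0 < d).
Implicit Types (c z : R * R) (phi y s : R).

Definition on_line y := exists j : int, y = j%:~R * d.

(* Some j d lies (weakly) between y and y + s. *)
Definition crosses y s := exists j : int, (j%:~R * d - y) * (j%:~R * d - (y + s)) <= 0.

Lemma int_gap (i j : int) : i <> j -> d <= `|i%:~R * d - j%:~R * d|.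
Proof.
move=> ij; rewrite -mulrBl normrM (gtr0_norm d0) ler_peMl ?(ltW d0)//.
rewrite -intrB -intr_norm -[1]/(1%:~R) ler_int.
by rewrite -gtz0_ge1 normr_gt0 subr_eq0; apply/eqP.
Qed.

Lemma polar_shift0 c phi : polar_shift c 0 phi = c.
Proof. by rewrite /polar_shift !mul0r !addr0; case: c. Qed.

(** The distance [l] from the pivot replaces the affine parameter, which makes points on arms of
    different lengths comparable. The parameter [l / r] is replaced by 0 when [r = 0]. *)
Lemma segment_polarP c (r phi : R) z : 0 <= r ->
  segment c (polar_shift c r phi) z <->
  exists2 l, 0 <= l <= r & z = polar_shift c l phi.
Proof.
move=> r0; split=> [[t [/andP[t0 t1] ->]]|[l /andP[l0 lr] ->]].
  exists (t * r); first by rewrite mulr_ge0//= ler_piMl.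
  by rewrite /polar_shift/=; congr pair; ring.
have [r00|rn0] := eqVneq r 0.
  have -> : l = 0 by lra.
  exists 0; split; first by rewrite lexx ler01.
  by rewrite r00 !polar_shift0 !mul0r !addr0; case: c.
exists (l / r); split.
  by rewrite divr_ge0//= ler_pdivrMr ?mul1r// lt_neqAle eq_sym rn0.
by rewrite /polar_shift/=; congr pair; field.
Qed.

Lemma polar_shift_inj c phi : injective (polar_shift c ^~ phi).
Proof.
move=> l l' [/addrI e1 /addrI e2].
have : (l - l') * (cos phi ^+ 2 + sin phi ^+ 2) = 0.
  by transitivity ((l * cos phi - l' * cos phi) * cos phi +
    (l * sin phi - l' * sin phi) * sin phi); [ring|rewrite e1 e2; ring].
by rewrite cos2Dsin2 mulr1 => /eqP; rewrite subr_eq0 => /eqP.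
Qed.

Lemma abs_shift_le (l phi : R) : `|l * sin phi| <= `|l|.
Proof. by rewrite normrM ler_piMr// ler_norml sin_geN1 sin_le1. Qed.

(** Two hits on one line would make the ray horizontal, with its pivot on that line. Hits on
    different lines are at least [d] apart, so one of them would be the pivot itself. *)
Lemma off_line_ray_inj y phi (l l' : R) : ~ on_line y -> 0 <= l <= d -> 0 <= l' <= d ->
  on_line (y + l * sin phi) -> on_line (y + l' * sin phi) -> l = l'.
Proof.
move=> off /andP[l0 ld] /andP[l0' ld'] [j ej] [j' ej'].
have dif : (l - l') * sin phi = j%:~R * d - j'%:~R * d by rewrite -ej -ej'; ring.
have [jj|jj] := eqVneq j j'.
  move: dif; rewrite jj subrr => /eqP; rewrite mulf_eq0 subr_eq0.
  case/orP => /eqP // s0; case: off; exists j'.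
  by rewrite -ej' s0 mulr0 addr0.
have gap : d <= `|l - l'|.
  apply: le_trans (abs_shift_le (l - l') phi); rewrite dif.
  by apply: int_gap; exact/eqP.
have : l = 0 \/ l' = 0 by move: gap; case: (ger0P (l - l')) => ? ?; [right|left]; lra.
move=> [e0|e0]; case: off; [exists j|exists j'].
  by rewrite -ej e0 mul0r addr0.
by rewrite -ej' e0 mul0r addr0.
Qed.

(** The common point has a single distance from [c], so [l = l'], and this positive factor
    cancels. *)
Lemma same_direction c (l l' phi psi : R) : 0 < l -> 0 < l' ->
  polar_shift c l phi = polar_shift c l' psi ->
  cos phi = cos psi /\ sin phi = sin psi.
Proof.
move=> l0 l0' [/addrI e1 /addrI e2].
have ll : l = l'.
  apply/eqP; rewrite -(@eqrXn2 _ 2)// ?(ltW l0) ?(ltW l0')//; apply/eqP.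
  transitivity ((l * cos phi) ^+ 2 + (l * sin phi) ^+ 2).
    by rewrite !exprMn -mulrDr cos2Dsin2 mulr1.
  by rewrite e1 e2 !exprMn -mulrDr cos2Dsin2 mulr1.
rewrite -ll in e1 e2; have ln0 : l != 0 by rewrite gt_eqF.
by split; [exact: (mulfI ln0)|exact: (mulfI ln0)].
Qed.

(** For a line at ordinate u and l = (u - y) / sin phi, the product in [crosses] equals l (l - r)
    sin^2 phi, which is nonpositive exactly for l between 0 and r. The quantifier over real [l] thus
    becomes one over countably many lines, as measurability requires. *)
Lemma crossesP y (r phi : R) : 0 <= r ->
  crosses y (r * sin phi) <-> exists2 l, 0 <= l <= r & on_line (y + l * sin phi).
Proof.
move=> r0; split => [[j]|[l /andP[l0 lr] [j ej]]]; last first.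
  exists j; rewrite -ej.
  have -> : (y + l * sin phi - y) * (y + l * sin phi - (y + r * sin phi)) =
    - (l * (r - l) * sin phi ^+ 2) by ring.
  by rewrite oppr_le0 mulr_ge0 ?sqr_ge0// mulr_ge0// subr_ge0.
set u := j%:~R * d => uy.
have [s0|sn0] := eqVneq (r * sin phi) 0.
  exists 0; first by rewrite lexx.
  exists j; rewrite mul0r addr0 -/u; move: uy; rewrite s0 addr0 => uy.
  by apply/eqP; rewrite eq_sym -subr_eq0 -sqrf_eq0 eq_le sqr_ge0 expr2 uy.
have rn0 : r != 0 by apply: contraNneq sn0 => ->; rewrite mul0r.
have sp0 : sin phi != 0 by apply: contraNneq sn0 => ->; rewrite mulr0.
pose l := (u - y) / sin phi.
have yl : y + l * sin phi = u by rewrite /l; field.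
have : l * (l - r) <= 0.
  have -> : l * (l - r) = (u - y) * (u - (y + r * sin phi)) / sin phi ^+ 2.
    by rewrite /l; field.
  by rewrite pmulr_lle0// invr_gt0 exprn_even_gt0.
move=> ll; exists l; last by exists j.
have [l0|l0] := leP 0 l; have [lr|lr] := leP l r => //=.
  by exfalso; nra.
- by exfalso; nra.
- by exfalso; nra.
Qed.

End geometry.

(** * Counting hits, with the pivot off or on a lattice line *)

Section counting.
Local Open Scope card_scope.
Context {R : realType}.
Variables (d : R) (d0 : 0 < d).
Implicit Types (c z : R * R) (phi psi y s r : R).

Definition ray_hits c r phi : set (R * R) :=
  [set z | exists2 l, 0 <= l <= r & z = polar_shift c l phi /\ on_line d z.2].

Lemma needle_hitsE a b c alpha beta : 0 <= a -> 0 <= b ->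
  pivot_needle a b c alpha beta `&` line_lattice d =
  ray_hits c a alpha `|` ray_hits c b beta.
Proof.
move=> a0 b0; rewrite /pivot_needle setIUl; congr (_ `|` _); apply/seteqP; split => z.
- by move=> [/(segment_polarP _ _ _ a0)[l lr ->] h]; exists l.
- by move=> [l lr [-> h]]; split => //; apply/(segment_polarP _ _ _ a0); exists l.
- by move=> [/(segment_polarP _ _ _ b0)[l lr ->] h]; exists l.
- by move=> [l lr [-> h]]; split => //; apply/(segment_polarP _ _ _ b0); exists l.
Qed.

Lemma ray_hits_no_crossing c r phi : 0 <= r -> ~ crosses d c.2 (r * sin phi) ->
  ray_hits c r phi = set0.
Proof.
move=> r0 nc; apply/seteqP; split => // z [l lr [-> h]]; apply: nc.
by apply/(crossesP d c.2 phi r0); exists l.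
Qed.

Lemma ray_hits_crossing c r phi : 0 <= r -> r <= d -> ~ on_line d c.2 ->
  crosses d c.2 (r * sin phi) ->
  exists l, [/\ 0 < l <= r, on_line d (c.2 + l * sin phi) &
    ray_hits c r phi = [set polar_shift c l phi]].
Proof.
move=> r0 rd off /(crossesP d c.2 phi r0)[l /andP[l0 lr] h].
exists l; split => //.
  rewrite lr andbT lt_neqAle l0 andbT; apply/eqP => e.
  by apply: off; move: h; rewrite -e mul0r addr0.
apply/seteqP; split => z.
  move=> [l' /andP[l0' lr'] [-> h']].
  by rewrite (off_line_ray_inj d0 off _ _ h' h)// ?l0 ?l0' /= ?(le_trans lr) ?(le_trans lr').
by move=> ->; exists l; rewrite ?l0.
Qed.

Variables (a b : R) (a0 : 0 <= a) (b0 : 0 <= b) (abd : a + b <= d).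

Let ad : a <= d. Proof. by move: a0 b0 abd; lra. Qed.
Let bd : b <= d. Proof. by move: a0 b0 abd; lra. Qed.

Section off_line.
Variables (c : R * R) (alpha beta : R).
Hypothesis off : ~ on_line d c.2.
Local Notation S := (pivot_needle a b c alpha beta `&` line_lattice d).
Local Notation cA := (crosses d c.2 (a * sin alpha)).
Local Notation cB := (crosses d c.2 (b * sin beta)).
Local Notation same := (cos alpha = cos beta /\ sin alpha = sin beta).

Lemma hits0_off_line : ~ cA -> ~ cB -> S #= `I_0.
Proof.
by move=> nA nB; rewrite needle_hitsE// !ray_hits_no_crossing// setU0 II0 card_eq00.
Qed.

Lemma hits2_off_line : cA -> cB -> ~ same -> S #= `I_2.
Proof.
move=> hA hB ns; rewrite needle_hitsE//.
have [l [/andP[l0 _] _ ->]] := ray_hits_crossing a0 ad off hA.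
have [l' [/andP[l0' _] _ ->]] := ray_hits_crossing b0 bd off hB.
by apply: card_set2 => /(same_direction l0 l0').
Qed.

Lemma hits1_off_line : cA \/ cB -> ~ (cA /\ cB /\ ~ same) -> S #= `I_1.
Proof.
move=> hAB ns; rewrite needle_hitsE//.
have [hA|nA] := pselect cA; have [hB|nB] := pselect cB.
- have [l [/andP[l0 la] h ->]] := ray_hits_crossing a0 ad off hA.
  have [l' [/andP[l0' lb] h' ->]] := ray_hits_crossing b0 bd off hB.
  have [ec es] : same by apply: contrapT => ?; exact: ns.
  (* Arms of equal direction lie on one ray, which carries a single hit within distance [d]. *)
  have ll : l = l'.
    rewrite -es in h'; apply: (off_line_ray_inj d0 off _ _ h h').
      by rewrite ltW//= (le_trans la ad).
    by rewrite ltW//= (le_trans lb bd).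
  by rewrite /polar_shift -ll -ec -es setUid card_set1.
- have [l [_ _ ->]] := ray_hits_crossing a0 ad off hA.
  by rewrite ray_hits_no_crossing// setU0 card_set1.
- have [l [_ _ ->]] := ray_hits_crossing b0 bd off hB.
  by rewrite ray_hits_no_crossing// set0U card_set1.
- by case: hAB.
Qed.
End off_line.

Section on_line.
Variable c : R * R.
Hypothesis on : on_line d c.2.

Lemma ray_hits_pivot r phi : 0 <= r -> ray_hits c r phi c.
Proof. by move=> r0; exists 0; rewrite ?polar_shift0 ?lexx ?r0. Qed.

Lemma ray_hits_horizontal r phi l : sin phi = 0 -> 0 <= l <= r ->
  ray_hits c r phi (polar_shift c l phi).
Proof.
by move=> s0 lr; exists l => //; split => //; rewrite /polar_shift/= s0 mulr0 addr0.
Qed.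

(** The first hypothesis excludes horizontal arms of positive length. Seen from a pivot on a line,
    the next line is at distance [d], so an arm of length at most [d] reaches it only with its
    endpoint and at a right angle. *)
Lemma ray_hits_cases r phi l : (r * sin phi = 0 -> r = 0) -> r <= d ->
  0 <= l <= r -> on_line d (c.2 + l * sin phi) ->
  l = 0 \/ (l = d /\ `|r * sin phi| = d).
Proof.
move=> nh rd /andP[l0 lr] [j ej]; case: on => i ei.
have dif : l * sin phi = j%:~R * d - i%:~R * d by rewrite -ej -ei; ring.
have [ij|ij] := eqVneq j i.
  left; move: dif; rewrite ij subrr => /eqP; rewrite mulf_eq0 => /orP[/eqP//|/eqP s0].
  have r0 : r = 0 by apply: nh; rewrite s0 mulr0.
  lra.
right; have gap : d <= `|l * sin phi|.
  by rewrite dif; apply: (int_gap d0); exact/eqP.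
have := abs_shift_le l phi; rewrite (ger0_norm l0) => ll.
have e : l = d by lra.
have er : r = l by lra.
by split => //; rewrite er; lra.
Qed.

Lemma ray_hits_near r phi : 0 <= r -> (r * sin phi = 0 -> r = 0) -> r <= d ->
  `|r * sin phi| <> d -> ray_hits c r phi = [set c].
Proof.
move=> r0 nh rd nf; apply/seteqP; split => z; last by move=> ->; exact: ray_hits_pivot.
move=> [l lr [-> h]]; have [->|[_ /nf//]] := ray_hits_cases nh rd lr h.
by rewrite polar_shift0.
Qed.

Lemma ray_hits_far r phi : 0 <= r -> r <= d -> `|r * sin phi| = d ->
  r = d /\ exists2 q, c <> q & ray_hits c r phi = [set c; q].
Proof.
move=> r0 rd far; have := abs_shift_le r phi; rewrite far ger0_norm// => dr.
have er : r = d by lra.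
have sn0 : r * sin phi != 0.
  by apply/eqP => e; move: far d0; rewrite e normr0 => <-; rewrite ltxx.
split => //; exists (polar_shift c r phi).
  rewrite -[in LHS](polar_shift0 c phi) => /polar_shift_inj e.
  by move: sn0; rewrite -e mul0r eqxx.
apply/seteqP; split => z.
  move=> [l lr [-> h]].
  have [->|[-> _]] := ray_hits_cases (fun e => False_ind _ (elimN eqP sn0 e)) rd lr h.
    by left; rewrite polar_shift0.
  by right; rewrite er.
move=> [->|->]; first exact: ray_hits_pivot.
exists r; rewrite ?r0 ?lexx//; split => //.
case: on => i ei; move: far.
(* The sign of the vertical displacement decides between the line above and the line below. *)
case: (ger0P (r * sin phi)) => _ e; [exists (i + 1)|exists (i - 1)].
  by rewrite /polar_shift/= e ei intrD; ring.
by rewrite /polar_shift/= -[r * _]opprK e ei intrB; ring.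
Qed.

Variables alpha beta : R.
Local Notation S := (pivot_needle a b c alpha beta `&` line_lattice d).

(** Used for a pivot on a lattice line, where a horizontal arm of positive length is contained in
    that line. *)
Definition lies_on_line :=
  (0 < a /\ a * sin alpha = 0) \/ (0 < b /\ b * sin beta = 0).
(** Used for a pivot on a lattice line: some arm ends on a neighbouring line. *)
Definition spans_strip := `|a * sin alpha| = d \/ `|b * sin beta| = d.

Lemma card_horizontal_ray r phi (A : set (R * R)) n : 0 < r -> r * sin phi = 0 ->
  ray_hits c r phi `<=` A -> (n <= 2)%N -> ~ (A #= `I_n).
Proof.
move=> r0 /eqP; rewrite mulf_eq0 (gt_eqF r0)/= => /eqP s0 rA.
have inj : injective (polar_shift c ^~ phi) := @polar_shift_inj _ c phi.
apply: (@card_ge3 _ _ _ (polar_shift c 0 phi) (polar_shift c (r / 2) phi)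
  (polar_shift c r phi)).
- by apply/rA/ray_hits_horizontal => //; rewrite lexx ltW.
- by apply/rA/ray_hits_horizontal => //; apply/andP; split; lra.
- by apply/rA/ray_hits_horizontal => //; rewrite lexx ltW.
- by move=> /inj; lra.
- by move=> /inj; lra.
- by move=> /inj; lra.
Qed.

Lemma hits_infinite_on_line n : lies_on_line -> (n <= 2)%N -> ~ (S #= `I_n).
Proof.
rewrite needle_hitsE// => -[[r0 s0]|[r0 s0]]; apply: card_horizontal_ray r0 s0 _.
  by left.
by right.
Qed.

Let not_lying r phi : ~ (0 < r /\ r * sin phi = 0) -> 0 <= r -> r * sin phi = 0 -> r = 0.
Proof.
by move=> nl r0 s0; apply: contrapT => /eqP rn0; apply: nl; rewrite lt_neqAle eq_sym rn0.
Qed.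

Lemma hits2_on_line : ~ lies_on_line -> spans_strip -> S #= `I_2.
Proof.
have zn phi : `|0 * sin phi| <> d by rewrite mul0r normr0 => e; move: d0; rewrite -e ltxx.
move=> nl [far|far]; rewrite needle_hitsE//.
- have [ea [q cq ->]] := ray_hits_far a0 ad far.
  (* An arm of length [d] exhausts the bound on [a + b]; the other arm shrinks to the pivot, which
     is already counted. *)
  have -> : b = 0 by move: b0 abd; rewrite ea; lra.
  by rewrite (ray_hits_near _ _ _ (zn _))// ?ltW// setUAC setUid; exact: card_set2.
- have [eb [q cq ->]] := ray_hits_far b0 bd far.
  have -> : a = 0 by move: a0 abd; rewrite eb; lra.
  by rewrite (ray_hits_near _ _ _ (zn _))// ?ltW// setUA setUid; exact: card_set2.
Qed.

Lemma hits1_on_line : ~ lies_on_line -> ~ spans_strip -> S #= `I_1.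
Proof.
move=> nl nf; rewrite needle_hitsE// !ray_hits_near//; first by rewrite setUid card_set1.
- by apply: not_lying => // h; apply: nl; right.
- by move=> h; apply: nf; right.
- by apply: not_lying => // h; apply: nl; left.
- by move=> h; apply: nf; left.
Qed.
End on_line.
End counting.

Section counting_summary.
Local Open Scope card_scope.
Context {R : realType}.
Variables (d : R) (d0 : 0 < d) (a b : R) (a0 : 0 <= a) (b0 : 0 <= b)
  (abd : a + b <= d).
Variables (c : R * R) (alpha beta : R).
Local Notation S := (pivot_needle a b c alpha beta `&` line_lattice d).
Local Notation on := (on_line d c.2).
Local Notation cA := (crosses d c.2 (a * sin alpha)).
Local Notation cB := (crosses d c.2 (b * sin beta)).
Local Notation same := (cos alpha = cos beta /\ sin alpha = sin beta).
Local Notation lies := (lies_on_line a b alpha beta).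
Local Notation spans := (spans_strip d a b alpha beta).

(** Pivots on a line have probability 0, but they are classified too, because the events themselves,
    and not only their almost sure versions, must be measurable. The cases exclude each other since
    a set has only one cardinality. *)
Lemma hits_iff :
  [/\ S #= `I_0 <-> ~ on /\ ~ cA /\ ~ cB,
      S #= `I_1 <-> (~ on /\ (cA \/ cB) /\ ~ (cA /\ cB /\ ~ same)) \/
                    (on /\ ~ lies /\ ~ spans) &
      S #= `I_2 <-> (~ on /\ (cA /\ cB /\ ~ same)) \/ (on /\ ~ lies /\ spans)].
Proof.
have U n m : S #= `I_n -> S #= `I_m -> n = m := @card_unique _ S n m.
have [hon|off] := pselect on.
  have [hl|nl] := pselect lies.
    have I := hits_infinite_on_line a0 b0 hon hl.
    have I0 := I 0%N isT; have I1 := I 1%N isT; have I2 := I 2%N isT.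
    by split; tauto.
  have [hs|ns] := pselect spans.
    have h2 := hits2_on_line d0 a0 b0 abd hon nl hs.
    have h0 : ~ (S #= `I_0) by move=> /(U _ _ h2).
    have h1 : ~ (S #= `I_1) by move=> /(U _ _ h2).
    by split; tauto.
  have h1 := hits1_on_line d0 a0 b0 abd hon nl ns.
  have h0 : ~ (S #= `I_0) by move=> /(U _ _ h1).
  have h2 : ~ (S #= `I_2) by move=> /(U _ _ h1).
  by split; tauto.
have [hAB|nAB] := pselect (cA \/ cB); last first.
  have h0 : S #= `I_0 by apply: hits0_off_line => //; tauto.
  have h1 : ~ (S #= `I_1) by move=> /(U _ _ h0).
  have h2 : ~ (S #= `I_2) by move=> /(U _ _ h0).
  by split; tauto.
have [h|nh] := pselect (cA /\ cB /\ ~ same).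
  have h2 : S #= `I_2 by apply: hits2_off_line => //; tauto.
  have h0 : ~ (S #= `I_0) by move=> /(U _ _ h2).
  have h1 : ~ (S #= `I_1) by move=> /(U _ _ h2).
  by split; tauto.
have h1 : S #= `I_1 by apply: hits1_off_line => //; tauto.
have h0 : ~ (S #= `I_0) by move=> /(U _ _ h1).
have h2 : ~ (S #= `I_2) by move=> /(U _ _ h1).
by split; tauto.
Qed.
End counting_summary.

Section strip.
Context {R : realType}.
Variables (d : R) (d0 : 0 < d).

Lemma off_line_strip (y : R) : 0 < y < d -> ~ on_line d y.
Proof.
move=> /andP[y0 yd] [j ej]; rewrite ej in y0 yd.
move: y0 yd; rewrite pmulr_lgt0// ltr0z => j0.
by rewrite ltNge ler_peMl ?(ltW d0)// -[1]/(1%:~R) ler_int.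
Qed.

(** Any other lattice line is separated from the pivot by the one at ordinate 0 or the one at [d],
    so these two serve as witnesses. *)
Lemma crosses_strip (y s : R) : 0 < y < d -> crosses d y s <-> ~ 0 < y + s < d.
Proof.
move=> /andP[y0 yd]; split.
  move=> [j hj] /andP[ys0 ysd].
  have [j0|j0] := leP j 0.
    have : j%:~R * d <= 0 by rewrite pmulr_lle0// lerz0.
    by move: hj; nra.
  have : d <= j%:~R * d by rewrite ler_peMl ?(ltW d0)// -[1]/(1%:~R) ler_int.
  by move: hj; nra.
move=> nb; have [ys|ys] := leP (y + s) 0; first by exists 0; rewrite mul0r; nra.
have [ysd|ysd] := leP d (y + s); first by exists 1; rewrite mul1r; nra.
by case: nb; rewrite ys ysd.
Qed.
End strip.

(** * Measurability of the events and equality up to null sets *)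

Section event_measurability.
Context disp (T : measurableType disp) {R : realType}.
Implicit Types f g : T -> R.

Lemma measurable_exists_int (Q : int -> set T) : (forall j, measurable (Q j)) ->
  measurable [set w | exists j, Q j w].
Proof.
move=> mQ; have -> : [set w | exists j, Q j w] =
    \bigcup_n (Q (Posz n) `|` Q (Negz n)).
  apply/seteqP; split => w /=.
    by move=> [[n|n] Qw]; exists n => //; [left|right].
  by move=> [n _ [Qw|Qw]]; eexists; exact: Qw.
by apply: bigcupT_measurable => n; exact: measurableU.
Qed.

Lemma measurable_set_eq f g : measurable_fun setT f -> measurable_fun setT g ->
  measurable [set w | f w = g w].
Proof.
move=> mf mg; have -> : [set w | f w = g w] = setT `&` (fun w => f w - g w) @^-1` [set 0].
  rewrite setTI; apply/seteqP; split => w /=; first by move=> ->; rewrite subrr.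
  by move/eqP; rewrite subr_eq0 => /eqP.
by apply: measurable_funB.
Qed.

Lemma measurable_set_le0 f : measurable_fun setT f -> measurable [set w | f w <= 0].
Proof.
move=> mf; have -> : [set w | f w <= 0] = setT `&` f @^-1` `]-oo, 0].
  by rewrite setTI; apply/seteqP; split => w /=; rewrite in_itv/=.
exact: mf.
Qed.

Lemma measurable_on_line (d : R) f : measurable_fun setT f ->
  measurable [set w | on_line d (f w)].
Proof. by move=> mf; apply: measurable_exists_int => j; exact: measurable_set_eq. Qed.

Lemma measurable_crosses (d : R) f g : measurable_fun setT f -> measurable_fun setT g ->
  measurable [set w | crosses d (f w) (g w)].
Proof.
move=> mf mg; apply: measurable_exists_int => j; apply: measurable_set_le0.
by apply: measurable_funM; apply: measurable_funB => //; exact: measurable_funD.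
Qed.

(** This form and the next ones let a propositional description of an event be taken apart
    connective by connective. *)
Lemma measurable_set_and (A B : T -> Prop) : measurable [set w | A w] ->
  measurable [set w | B w] -> measurable [set w | A w /\ B w].
Proof. exact: measurableI. Qed.

Lemma measurable_set_or (A B : T -> Prop) : measurable [set w | A w] ->
  measurable [set w | B w] -> measurable [set w | A w \/ B w].
Proof. exact: measurableU. Qed.

Lemma measurable_set_not (A : T -> Prop) : measurable [set w | A w] ->
  measurable [set w | ~ A w].
Proof. exact: measurableC. Qed.

Lemma measurable_set_prop (A : Prop) : measurable [set _ : T | A].
Proof.
have [hA|nA] := pselect A.
  by rewrite (_ : [set _ | A] = setT)//; apply/seteqP; split.
by rewrite (_ : [set _ | A] = set0)//; apply/seteqP; split.
Qed.

Lemma measure_eq_off_null (P : {measure set T -> \bar R}) (A B N : set T) :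
  measurable A -> measurable B -> measurable N -> P N = 0%E ->
  (forall w, ~ N w -> A w <-> B w) -> P A = P B.
Proof.
move=> mA mB mN N0 AB.
have E C : measurable C -> P C = P (C `\` N).
  move=> mC; rewrite (measureDI P mC mN) (@subset_measure0 _ _ _ P (C `&` N) N) ?adde0//.
  exact: measurableI.
rewrite (E A mA) (E B mB); congr (P _); apply/seteqP; split => w -[h nN]; split => //.
  exact/(AB _ nN).
exact/(AB _ nN).
Qed.
End event_measurability.

(** * Probabilities of the events *)

Section pivot_needle_probabilities.
Context {R : realType} disp (T : measurableType disp) (P : probability T R).
Variables (d a b x0 : R) (Y alpha beta : {RV P >-> R}).
Hypotheses (hd : 0 < d) (ha : 0 <= a) (hb : 0 <= b) (habd : a + b <= d).
Variables (h : (0 : R) < 2 * pi).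
Local Notation U := (uniform_prob h).
Local Notation V := (uniform_prob hd).
Local Notation hit := (hits_exactly d a b x0 Y alpha beta).

Let mY : measurable_fun setT Y. Proof. exact: measurable_funPT. Qed.
Let malpha : measurable_fun setT alpha. Proof. exact: measurable_funPT. Qed.
Let mbeta : measurable_fun setT beta. Proof. exact: measurable_funPT. Qed.

Lemma measurable_hits i : (i <= 2)%N -> measurable (hit i).
Proof.
have ms : measurable_fun setT (fun w => a * sin (alpha w)).
  by apply: measurable_funM => //; exact: measurable_sinT.
have mt : measurable_fun setT (fun w => b * sin (beta w)).
  by apply: measurable_funM => //; exact: measurable_sinT.
have mon := measurable_on_line d mY.
have mcA := measurable_crosses d mY ms.
have mcB := measurable_crosses d mY mt.
have msame : measurable [set w | cos (alpha w) = cos (beta w) /\ sin (alpha w) = sin (beta w)].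
  apply: measurable_set_and; apply: measurable_set_eq.
  - exact: measurable_cosT.
  - exact: measurable_cosT.
  - exact: measurable_sinT.
  - exact: measurable_sinT.
have mlies : measurable [set w | lies_on_line a b (alpha w) (beta w)].
  apply: measurable_set_or; apply: measurable_set_and.
  - exact: measurable_set_prop.
  - exact: measurable_set_eq.
  - exact: measurable_set_prop.
  - exact: measurable_set_eq.
have mspans : measurable [set w | spans_strip d a b (alpha w) (beta w)].
  by apply: measurable_set_or; apply: measurable_set_eq => //; exact: measurable_normT.
have H w := hits_iff hd ha hb habd (x0, Y w) (alpha w) (beta w).
case: i => [|[|[|//]]] _.
- rewrite (_ : hit 0%N = [set w | ~ on_line d (Y w) /\
    ~ crosses d (Y w) (a * sin (alpha w)) /\ ~ crosses d (Y w) (b * sin (beta w))]).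
    by do ![apply: measurable_set_and|apply: measurable_set_not].
  by apply/seteqP; split => w; have [[]] := H w.
- rewrite (_ : hit 1%N = [set w | (~ on_line d (Y w) /\
      (crosses d (Y w) (a * sin (alpha w)) \/ crosses d (Y w) (b * sin (beta w))) /\
      ~ (crosses d (Y w) (a * sin (alpha w)) /\ crosses d (Y w) (b * sin (beta w)) /\
         ~ (cos (alpha w) = cos (beta w) /\ sin (alpha w) = sin (beta w)))) \/
      (on_line d (Y w) /\ ~ lies_on_line a b (alpha w) (beta w) /\
       ~ spans_strip d a b (alpha w) (beta w))]).
    by do ![exact|apply: measurable_set_or|apply: measurable_set_and|apply: measurable_set_not].
  by apply/seteqP; split => w; have [_ []] := H w.
- rewrite (_ : hit 2%N = [set w | (~ on_line d (Y w) /\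
      (crosses d (Y w) (a * sin (alpha w)) /\ crosses d (Y w) (b * sin (beta w)) /\
         ~ (cos (alpha w) = cos (beta w) /\ sin (alpha w) = sin (beta w)))) \/
      (on_line d (Y w) /\ ~ lies_on_line a b (alpha w) (beta w) /\
       spans_strip d a b (alpha w) (beta w))]).
    by do ![exact|apply: measurable_set_or|apply: measurable_set_and|apply: measurable_set_not].
  by apply/seteqP; split => w; have [_ _ []] := H w.
Qed.

Hypothesis hY : forall A, measurable A -> P (Y @^-1` A) = V A.
Hypothesis halpha : forall A, measurable A -> P (alpha @^-1` A) = U A.
Hypothesis hbeta : forall A, measurable A -> P (beta @^-1` A) = U A.
Hypothesis hind : independent3 Y alpha beta.

(** The variables are reordered as in [avoiding]: the angles first, the pivot ordinate last. *)
Let XYZ (A B C : set R) : measurable A -> measurable B -> measurable C ->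
  P (alpha @^-1` A `&` beta @^-1` B `&` Y @^-1` C) = (U A * U B * V C)%E.
Proof.
move=> mA mB mC; rewrite setIC setIA hind// hY// halpha// hbeta//.
by rewrite -muleA muleC.
Qed.

Let angles_law (C : set (R * R)) : measurable C ->
  P ((fun w => (alpha w, beta w)) @^-1` C) = (U \x U)%E C.
Proof.
exact: (@joint_law_product2 _ T R P _ _ _ _ _ _ U U V alpha beta Y malpha mbeta (@XYZ)).
Qed.

Let angles_pivot_law (C : set ((R * R) * R)) : measurable C ->
  P ((fun w => ((alpha w, beta w), Y w)) @^-1` C) = ((U \x U) \x V)%E C.
Proof.
exact: (@joint_law_product3 _ T R P _ _ _ _ _ _ U U V alpha beta Y malpha mbeta mY (@XYZ)).
Qed.

(** Outside this set the pivot is in the open strip and the arms have different directions. Equality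
    of the cosines alone is weaker than equality of directions, but still a null event. *)
Definition exceptional : set T :=
  [set w | ~ 0 < Y w < d] `|` [set w | cos (alpha w) = cos (beta w)].

Lemma measurable_exceptional : measurable exceptional.
Proof.
apply: measurableU.
  by apply: measurable_set_not; exact: measurable_fun_oo.
by apply: measurable_set_eq; exact: measurable_cosT.
Qed.

Lemma exceptional_null : P exceptional = 0%E.
Proof.
have m1 : measurable [set w | 0 < Y w < d] by exact: measurable_fun_oo.
have m2 : measurable [set w | cos (alpha w) = cos (beta w)].
  by apply: measurable_set_eq; exact: measurable_cosT.
have e2 : P [set w | cos (alpha w) = cos (beta w)] = 0%E.
  have := angles_law (@measurable_same_cos R).
  by rewrite same_cos_null.
have e1 : P [set w | ~ 0 < Y w < d] = 0%E.
  rewrite -[X in P X]/(~` [set w | 0 < Y w < d]) probability_setC//.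
  have -> : [set w | 0 < Y w < d] = Y @^-1` `]0, d[.
    by apply/seteqP; split => w /=; rewrite in_itv/=.
  rewrite hY// uniform_prob_oo// ?(ltW hd)// subr0 divff ?gt_eqF//.
  by rewrite subee.
rewrite /exceptional measureU0//; exact: measurable_set_not.
Qed.

(** The lengths are arguments because the event is needed for the whole needle and, with one length
    0, for each arm alone under the same throw. *)
Definition reaching (r s : R) : set T :=
  (fun w => ((alpha w, beta w), Y w)) @^-1` (~` avoiding r s d).

Lemma measurable_reaching r s : measurable (reaching r s).
Proof.
rewrite -[reaching r s]setTI.
have m := measurable_fun_pair (measurable_fun_pair malpha mbeta) mY.
by apply: m => //; apply: measurableC; exact: measurable_avoiding.
Qed.

Lemma probability_reaching r s i2 : 0 <= r -> 0 <= s -> r + s <= d ->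
  (\int[U]_x \int[U]_y `|r * sin x - s * sin y|%:E = i2%:E)%E ->
  P (reaching r s) = ((2 * r / pi + 2 * s / pi + i2) / (2 * d))%:E.
Proof.
move=> r0 s0 rs hi; rewrite -(product_measure_avoiding hd r0 s0 rs hi).
apply: angles_pivot_law.
by apply: measurableC; exact: measurable_avoiding.
Qed.

(** Buffon's classical probability. With the second arm of length 0, both |s| and |s - t| have mean
    2r / pi. *)
Lemma probability_reaching_l r : 0 <= r -> r <= d ->
  P (reaching r 0) = (2 * r / (pi * d))%:E.
Proof.
move=> r0 rd; rewrite (@probability_reaching _ _ (2 * r / pi))//; last 2 first.
- by rewrite addr0.
- rewrite -(mean_abs_sin h r0); apply: eq_integral => x _.
  under eq_integral do rewrite mul0r subr0.
  rewrite -[LHS]/(\int[U]_y cst `|r * sin x|%:E y)%E.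
  by rewrite integral_cst// [X in (_ * X)%E](@probability_setT _ _ _ U) mule1.
congr EFin; have p0 := pi_gt0 R; move: (@pi R) p0 => p p0.
by field; rewrite !gt_eqF.
Qed.

Lemma probability_reaching_r s : 0 <= s -> s <= d ->
  P (reaching 0 s) = (2 * s / (pi * d))%:E.
Proof.
move=> s0 sd; rewrite (@probability_reaching _ _ (2 * s / pi))//; last 2 first.
- by rewrite add0r.
- under eq_integral do under eq_integral do rewrite mul0r sub0r normrN.
  rewrite (mean_abs_sin h s0) -[LHS]/(\int[U]_x cst (2 * s / pi)%:E x)%E.
  by rewrite integral_cst// [X in (_ * X)%E](@probability_setT _ _ _ U) mule1.
congr EFin; have p0 := pi_gt0 R; move: (@pi R) p0 => p p0.
by field; rewrite !gt_eqF.
Qed.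

Lemma reachingU : reaching a b = reaching a 0 `|` reaching 0 b.
Proof. by rewrite /reaching avoidingE setCI preimage_setU. Qed.

Lemma reaching_crosses w : 0 < Y w < d ->
  (reaching a 0 w <-> crosses d (Y w) (a * sin (alpha w))) /\
  (reaching 0 b w <-> crosses d (Y w) (b * sin (beta w))).
Proof.
move=> Yw; rewrite !crosses_strip// /reaching /avoiding/= !mul0r !addr0 Yw.
split; split => [na h'|na [_ h1 h2]].
- by apply: na; split.
- exact: na.
- by apply: na; split.
- exact: na.
Qed.

Lemma probability_hit0 : P (hit 0%N) = (1 - P (reaching a b))%E.
Proof.
rewrite -probability_setC; last exact: measurable_reaching.
apply: (@measure_eq_off_null _ _ _ P _ _ exceptional).
- exact: measurable_hits.
- by apply: measurableC; exact: measurable_reaching.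
- exact: measurable_exceptional.
- exact: exceptional_null.
move=> w nw; have Yw : 0 < Y w < d by apply: contrapT => n; apply: nw; left.
have off := off_line_strip hd Yw; have [rA rB] := reaching_crosses Yw.
have [H _ _] := hits_iff hd ha hb habd (x0, Y w) (alpha w) (beta w).
rewrite reachingU setCU /setI/=; rewrite /hits_exactly/= in H *; tauto.
Qed.

(** Each arm contributes at most one hit, and hits on arms of different directions are distinct. *)
Lemma probability_hit2 : P (hit 2%N) = P (reaching a 0 `&` reaching 0 b).
Proof.
apply: (@measure_eq_off_null _ _ _ P _ _ exceptional).
- exact: measurable_hits.
- by apply: measurableI; exact: measurable_reaching.
- exact: measurable_exceptional.
- exact: exceptional_null.
move=> w nw; have Yw : 0 < Y w < d by apply: contrapT => n; apply: nw; left.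
have ns : cos (alpha w) <> cos (beta w) by move=> n; apply: nw; right.
have off := off_line_strip hd Yw; have [rA rB] := reaching_crosses Yw.
have [_ _ H] := hits_iff hd ha hb habd (x0, Y w) (alpha w) (beta w).
rewrite /setI/=; rewrite /hits_exactly/= in H *; tauto.
Qed.

(** Counts other than 0, 1, 2 require the pivot on a line, so off the exceptional set the three
    events partition the space. *)
Lemma probability_hit1 : P (hit 1%N) = (1 - (P (hit 0%N) + P (hit 2%N)))%E.
Proof.
have m0 := measurable_hits (isT : (0 <= 2)%N).
have m2 := measurable_hits (isT : (2 <= 2)%N).
have <- : (P (hit 0%N `|` hit 2%N) = P (hit 0%N) + P (hit 2%N))%E.
  apply: measureU => //; apply/seteqP; split => // w [h0 h2].
  by have := card_unique h0 h2.
rewrite -probability_setC; last exact: measurableU.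
apply: (@measure_eq_off_null _ _ _ P _ _ exceptional).
- exact: measurable_hits.
- by apply: measurableC; exact: measurableU.
- exact: measurable_exceptional.
- exact: exceptional_null.
move=> w nw; have Yw : 0 < Y w < d by apply: contrapT => n; apply: nw; left.
have off := off_line_strip hd Yw.
have [H0 H1 H2] := hits_iff hd ha hb habd (x0, Y w) (alpha w) (beta w).
rewrite setCU /setI/=; rewrite /hits_exactly/= in H0 H1 H2 *.
have [?|?] := pselect (crosses d (Y w) (a * sin (alpha w)));
  have [?|?] := pselect (crosses d (Y w) (b * sin (beta w)));
  have [?|?] := pselect (cos (alpha w) = cos (beta w) /\ sin (alpha w) = sin (beta w)); tauto.
Qed.

End pivot_needle_probabilities.

Theorem mainTheorem1 (R : realType)
    (disp : measure_display) (T : measurableType disp) (P : probability T R)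
    (d a b k x0 : R) (Y alpha beta : {RV P >-> R})
    (hd : 0 < d) (ha : 0 <= a) (hb : 0 <= b)
    (hab : 0 < a + b) (habd : a + b <= d)
    (hk : 0 <= k) (hk2 : k ^+ 2 = 4 * a * b / (a + b) ^+ 2)
    (hY : uniformly_distributed Y 0 d)
    (halpha : uniformly_distributed alpha 0 (2 * pi))
    (hbeta : uniformly_distributed beta 0 (2 * pi))
    (hind : independent3 Y alpha beta) :
  let hit := hits_exactly d a b x0 Y alpha beta in
  let p := fun i : nat => P (hit i) in
  (forall i : nat, (i <= 2)%N -> measurable (hit i)) /\
  p 0%N = (1 - (a + b) * (pi + 2 * ellipticE k) / (pi ^+ 2 * d))%:E /\
  p 1%N = (4 * (a + b) * ellipticE k / (pi ^+ 2 * d))%:E /\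
  p 2%N = ((a + b) * (pi - 2 * ellipticE k) / (pi ^+ 2 * d))%:E.
Proof.
move=> hit p.
case: hY => uvY eY; case: halpha => h eA; case: hbeta => h' eB.
(* [uniform_prob] depends on a proof of a boolean inequality; all such proofs are equal, so the laws
   can be identified. *)
rewrite (bool_irrelevance h' h) in eB; rewrite (bool_irrelevance uvY hd) in eY.
have ad : a <= d by lra.
have bd : b <= d by lra.
have p0 := pi_gt0 R.
have pab := probability_reaching eY eA eB hind ha hb habd (mean_abs_sin_sub h hab hk2).
have pa := probability_reaching_l eY eA eB hind ha ad.
have pb := probability_reaching_r eY eA eB hind hb bd.
have p2 : P (hit 2%N) = ((a + b) * (pi - 2 * ellipticE k) / (pi ^+ 2 * d))%:E.
  rewrite (probability_hit2 x0 ha hb habd eY eA eB hind).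
  have mA := measurable_reaching d Y alpha beta a 0.
  have mB := measurable_reaching d Y alpha beta 0 b.
  have finB : (P (reaching d Y alpha beta 0 b) < +oo)%E by rewrite pb ltry.
  have incl_excl : (P (reaching d Y alpha beta a b) =
      P (reaching d Y alpha beta a 0) + P (reaching d Y alpha beta 0 b) -
      P (reaching d Y alpha beta a 0 `&` reaching d Y alpha beta 0 b))%E.
    by rewrite reachingU; exact: measureUfinr.
  rewrite -[LHS]fineK ?fin_num_measure//; last exact: measurableI.
  (* Among real numbers the inclusion-exclusion identity can be solved for the intersection, its
     only unknown term. *)
  move: incl_excl; rewrite -[X in (_ - X)%E]fineK ?fin_num_measure//; last exact: measurableI.
  set r := fine _; rewrite pab pa pb => -[e]; congr EFin.
  have -> : r = 2 * a / (pi * d) + 2 * b / (pi * d) -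
    (2 * a / pi + 2 * b / pi + 4 * (a + b) * ellipticE k / pi ^+ 2) / (2 * d).
    by rewrite e; ring.
  by clear -p0 hd; move: (@pi R) p0 => q q0; field; rewrite !gt_eqF.
have p0E : P (hit 0%N) = (1 - (a + b) * (pi + 2 * ellipticE k) / (pi ^+ 2 * d))%:E.
  rewrite (probability_hit0 x0 ha hb habd eY eA eB hind) pab -EFinB; congr EFin.
  by clear -p0 hd; move: (@pi R) p0 => q q0; field; rewrite !gt_eqF.
split; first by move=> i i2; exact: measurable_hits.
split=> //; split => //; rewrite /p.
rewrite (probability_hit1 x0 ha hb habd eY eA eB hind) p0E p2; congr EFin.
by clear -p0 hd; move: (@pi R) p0 => q q0; field; rewrite !gt_eqF.
Qed.
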